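(* Let $A,B,C$ be complex vector spaces of dimension $m$ and let $T\in A\otimes B\otimes C$ be a tight tensor. Then $T$ is $(\lceil m/2\rceil,\lceil m/2\rceil,\lfloor m/2\rfloor)$-compressible, and likewise $(\lceil m/2\rceil,\lfloor m/2\rfloor,\lceil m/2\rceil)$-compressible and $(\lfloor m/2\rfloor,\lceil m/2\rceil,\lceil m/2\rceil)$-compressible.
   Context: Write $[m]=\{1,\dots,m\}$. A subset $\mathcal{S}\subseteq[m]\times[m]\times[m]$ is tight if its three projections to $[m]$ are surjective and there exist injective functions $\tau_A,\tau_B,\tau_C:[m]\to\mathbb{Z}$ such that $\tau_A(i)+\tau_B(j)+\tau_C(k)=0$ for every $(i,j,k)\in\mathcal{S}$. A tensor $T\in A\otimes B\otimes C$ is tight if there are bases $\{a_i\},\{b_j\},\{c_k\}$ of $A,B,C$ such that, writing $T=\sum T^{ijk}a_i\otimes b_j\otimes c_k$, the support $\{(i,j,k):T^{ijk}\neq0\}$ is a tight subset. A tensor $T\in A\otimes B\otimes C$ is $(\mathbf a',\mathbf b',\mathbf c')$-compressible if there exist linear subspaces $A'\subseteq A^*$, $B'\subseteq B^*$, $C'\subseteq C^*$ of dimensions $\mathbf a',\mathbf b',\mathbf c'$ respectively such that $T|_{A'\otimes B'\otimes C'}=0$, where $T$ is regarded as a trilinear form on $A^*\times B^*\times C^*$. *)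

(* Defs.v *)
From HB Require Import structures.
From mathcomp Require Import all_boot all_order all_algebra.
From mathcomp Require Import reals complex.
Set Implicit Arguments.
Unset Strict Implicit.
Unset Printing Implicit Defensive.
Import Order.TTheory GRing.Theory Num.Theory.
Local Open Scope ring_scope.

Section TightSubset.
Variable m : nat.
Implicit Types S : {set 'I_m * 'I_m * 'I_m}.

Definition surjective_projections S : Prop :=
  [/\ [set x.1.1 | x in S] = [set: 'I_m],
      [set x.1.2 | x in S] = [set: 'I_m]
    & [set x.2 | x in S] = [set: 'I_m]].

Definition tight_set S : Prop :=
  surjective_projections S /\
  exists tauA tauB tauC : 'I_m -> int,
    [/\ injective tauA, injective tauB, injective tauC
      & forall i j k, (i, j, k) \in S -> tauA i + tauB j + tauC k = 0].

End TightSubset.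

Section Tensor.
Variable F : fieldType.

Local Notation dual V := 'Hom(V, F^o).

Definition eval_at (V : vectType F) (v : V) : 'Hom(dual V, F^o) :=
  linfun (fun phi : dual V => phi v).

Lemma eval_atE (V : vectType F) (v : V) (phi : dual V) : eval_at v phi = phi v.
Proof.
pose f (phi : dual V) : F^o := phi v.
have f_lin : linear f by move=> r x y; rewrite /f add_lfunE scale_lfunE.
pose fL := GRing.isLinear.Build F (dual V) F^o *:%R f f_lin.
pose f' : {linear dual V -> F^o} := HB.pack f fL.
exact: (lfunE f').
Qed.

Definition rank1 (U W : vectType F) (phi : dual U) (w : W) : 'Hom(U, W) :=
  linfun (fun u => (phi u : F) *: w).

Lemma rank1E (U W : vectType F) (phi : dual U) (w : W) u :
  rank1 phi w u = (phi u : F) *: w.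
Proof.
pose f u := (phi u : F) *: w.
have f_lin : linear f.
  by move=> r x y; rewrite /f linearP scalerDl scalerA.
pose fL := GRing.isLinear.Build F U W *:%R f f_lin.
pose f' : {linear U -> W} := HB.pack f fL.
exact: (lfunE f').
Qed.

Variables A B C : vectType F.

(* For finite-dimensional A, B, C, the space of trilinear forms on
   A^* x B^* x C^* (curried here) is a model of A (x) B (x) C, in which the
   decomposable tensor a (x) b (x) c is (alpha, beta, gamma) |->
   alpha(a) beta(b) gamma(c); see tens3E. *)
Definition tensor3 : vectType F := 'Hom(dual A, 'Hom(dual B, 'Hom(dual C, F^o))).

Definition tens3 (a : A) (b : B) (c : C) : tensor3 :=
  rank1 (eval_at a) (rank1 (eval_at b) (eval_at c)).

Lemma tens3E a b c (alpha : dual A) (beta : dual B) (gamma : dual C) :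
  tens3 a b c alpha beta gamma = alpha a * beta b * gamma c.
Proof.
rewrite /tens3 rank1E scale_lfunE rank1E !scale_lfunE !eval_atE.
exact: mulrA.
Qed.

Definition tight (m : nat) (T : tensor3) : Prop :=
  exists (a : m.-tuple A) (b : m.-tuple B) (c : m.-tuple C)
         (t : 'I_m -> 'I_m -> 'I_m -> F),
    [/\ basis_of {:A} a, basis_of {:B} b, basis_of {:C} c,
        T = \sum_(i < m) \sum_(j < m) \sum_(k < m)
              t i j k *: tens3 (tnth a i) (tnth b j) (tnth c k)
      & tight_set [set x : 'I_m * 'I_m * 'I_m | t x.1.1 x.1.2 x.2 != 0]].

Definition compressible (a' b' c' : nat) (T : tensor3) : Prop :=
  exists (A' : {vspace 'Hom(A, F^o)}) (B' : {vspace 'Hom(B, F^o)}) (C' : {vspace 'Hom(C, F^o)}),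
    [/\ \dim A' = a', \dim B' = b', \dim C' = c'
      & forall alpha beta gamma,
          alpha \in A' -> beta \in B' -> gamma \in C' ->
          T alpha beta gamma = 0].

End Tensor.

(* Main.v *)
Require Import Defs.
From HB Require Import structures.
From mathcomp Require Import all_boot all_order all_algebra.
From mathcomp Require Import reals complex.
From mathcomp Require Import zify.
Set Implicit Arguments.
Unset Strict Implicit.
Unset Printing Implicit Defensive.
Import Order.TTheory GRing.Theory Num.Theory.
Local Open Scope ring_scope.

(** Let x, y, z be medians of tau_A, tau_B, tau_C.  If x + y + z >= 0, then
  tau_A(i) >= x, tau_B(j) >= y and tau_C(k) > z force
  tau_A(i) + tau_B(j) + tau_C(k) > 0, so (i, j, k) is not in the support of T,
  and the spans of the corresponding dual basis vectors are the required
  subspaces; if x + y + z <= 0, reverse the inequalities.  The strict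
  inequality may be put on any of the three factors. *)

Lemma card_pred_codom (I : finType) (U : eqType) (f : I -> U) (p : pred U) :
  #|[pred i | p (f i)]| = count p (codom f).
Proof. by rewrite codomE count_map cardE enumT -size_filter. Qed.

(* The median of 2 * tau is used so that it can be an integer lying strictly
   between two values when m is even. *)
Lemma double_median (m : nat) (tau : 'I_m -> int) : injective tau ->
  exists x : int,
    [/\ (uphalf m <= #|[pred i | (x <= 2 * tau i)%R]|)%N,
        (uphalf m <= #|[pred i | (2 * tau i <= x)%R]|)%N,
        (m./2 <= #|[pred i | (x < 2 * tau i)%R]|)%N
      & (m./2 <= #|[pred i | (2 * tau i < x)%R]|)%N].
Proof.
(* For [m = 0] all four bounds are 0. Otherwise position [h] lies inside the sorted list of values,
   so [v] is a genuine value and not the default of [nth]. *)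
case: m tau => [|m] tau inj_tau; first by exists 0; split; rewrite ?leq0n.
pose s := sort <=%O (codom tau).
have uniq_s : uniq s by rewrite sort_uniq map_inj_uniq ?enum_uniq.
have sorted_s : sorted <%O s by rewrite sort_lt_sorted -(sort_uniq <=%O).
have size_s : size s = m.+1 by rewrite size_sort size_codom card_ord.
pose h := m.+1./2; pose v := nth 0 s h.
have lt_h : (h < size s)%N by rewrite size_s /h; lia.
(* Injectivity makes [s] strictly increasing, so exactly [h] of its entries lie below its entry [v]
   at position [h]. *)
have card_lt : #|[pred i | tau i < v]| = h.
  by rewrite (card_pred_codom tau (< v)) -(count_sort <=%O) count_lt_nth.
have card_le : #|[pred i | tau i <= v]| = h.+1.
  by rewrite (card_pred_codom tau (<= v)) -(count_sort <=%O) count_le_nth.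
have card_ge : #|[pred i | v <= tau i]| = (m.+1 - h)%N.
  have := cardC [pred i | tau i < v]; rewrite card_lt card_ord => /(canRL (addKn _)) <-.
  by apply: eq_card => i; rewrite !inE -leNgt.
have card_gt : #|[pred i | v < tau i]| = (m.+1 - h.+1)%N.
  have := cardC [pred i | tau i <= v]; rewrite card_le card_ord => /(canRL (addKn _)) <-.
  by apply: eq_card => i; rewrite !inE -ltNge.
clearbody v; case odd_m: (odd m.+1).
(* There are [2h + 1] values, and [v] is the middle one. *)
- exists (2 * v); split.
  + rewrite (@eq_card _ _ [pred i | v <= tau i]) ?card_ge /h; first lia.
    by move=> i; rewrite !inE; lia.
  + rewrite (@eq_card _ _ [pred i | tau i <= v]) ?card_le /h; first lia.
    by move=> i; rewrite !inE; lia.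
  + rewrite (@eq_card _ _ [pred i | v < tau i]) ?card_gt /h; first lia.
    by move=> i; rewrite !inE; lia.
  + rewrite (@eq_card _ _ [pred i | tau i < v]) ?card_lt /h; first lia.
    by move=> i; rewrite !inE; lia.
(* There are [2h] values. The odd number [2 * v - 1] equals no [2 * tau i] and has [h] of them on
   each side, so weak and strict inequalities agree. *)
- exists (2 * v - 1); split.
  + rewrite (@eq_card _ _ [pred i | v <= tau i]) ?card_ge /h; first lia.
    by move=> i; rewrite !inE; lia.
  + rewrite (@eq_card _ _ [pred i | tau i < v]) ?card_lt /h; first lia.
    by move=> i; rewrite !inE; lia.
  + rewrite (@eq_card _ _ [pred i | v <= tau i]) ?card_ge /h; first lia.
    by move=> i; rewrite !inE; lia.
  + rewrite (@eq_card _ _ [pred i | tau i < v]) ?card_lt /h; first lia.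
    by move=> i; rewrite !inE; lia.
Qed.

(** Take the span of [p] coordinate functionals of [v] with indices in [P]: each of them kills every
    [tnth v i] with [i] outside [P]. *)
Lemma dual_subspace (F : fieldType) (V : vectType F) (m p : nat)
    (v : m.-tuple V) (P : {pred 'I_m}) : free v -> (p <= #|P|)%N ->
  exists2 W : {vspace 'Hom(V, F^o)}, \dim W = p &
    forall phi i, phi \in W -> i \notin P -> phi (tnth v i) = 0.
Proof.
move=> free_v /card_geqP[s [uniq_s size_s sP]].
pose dual i : 'Hom(V, F^o) := linfun (coord v i : V -> F^o).
have dualE i j : dual i (tnth v j) = (j == i)%:R.
  by rewrite lfunE /= (tnth_nth 0) coord_free.
exists <<[seq dual i | i <- s]>>%VS; last first.
  move=> phi i phi_s iP; rewrite -eval_atE; apply/eqP; rewrite -memv_ker.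
  apply: subvP phi_s; apply/span_subvP => _ /mapP[j js ->].
  rewrite memv_ker eval_atE dualE; have [ij|] := eqVneq i; last by rewrite eqxx.
  by rewrite ij (sP _ js) in iP.
have size_dual : size [seq dual i | i <- s] == p by rewrite size_map size_s.
rewrite -[RHS](eqP size_dual); apply/eqP; change (free (Tuple size_dual)).
(* Evaluating a vanishing combination at the basis vector dual to its [i]-th functional isolates the
   coefficient [k i]. *)
apply/freeP => k /(congr1 (eval_at (tnth v _)))k0 i.
have i_s : (i < size s)%N by rewrite size_s.
(* A successor [m] provides [ord0] as default for [nth]; for [m = 0] the list [s] would be empty,
   against [i_s]. *)
case: m => [|m] in v P free_v s uniq_s size_s sP dual dualE size_dual k k0 i_s *.
  by case: s {uniq_s size_s sP size_dual k0} i_s => // -[].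
have := k0 (nth ord0 s i); rewrite linear0 eval_atE sum_lfunE.
rewrite (bigD1 i) //= big1 => [|j ji]; rewrite scale_lfunE (nth_map ord0) ?size_s //.
  by rewrite dualE eqxx addr0 => /eqP; rewrite mulf_eq0 oner_eq0 orbF => /eqP.
by rewrite dualE nth_uniq ?size_s // val_eqE eq_sym (negPf ji) scaler0.
Qed.

(** On the subspaces that [dual_subspace] attaches to [P], [Q], [S], a term with an index outside
    its block has a vanishing factor, and any other term has coefficient 0. *)
Lemma compressible_of_zero_block (F : fieldType) (A B C : vectType F)
    (m p q r : nat) (a : m.-tuple A) (b : m.-tuple B) (c : m.-tuple C)
    (t : 'I_m -> 'I_m -> 'I_m -> F) (P Q S : {pred 'I_m}) :
  free a -> free b -> free c ->
  (p <= #|P|)%N -> (q <= #|Q|)%N -> (r <= #|S|)%N ->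
  (forall i j k, i \in P -> j \in Q -> k \in S -> t i j k = 0) ->
  compressible p q r (\sum_(i < m) \sum_(j < m) \sum_(k < m)
    t i j k *: tens3 (tnth a i) (tnth b j) (tnth c k)).
Proof.
move=> free_a free_b free_c leP leQ leS t0.
have [A' dimA A'0] := dual_subspace free_a leP.
have [B' dimB B'0] := dual_subspace free_b leQ.
have [C' dimC C'0] := dual_subspace free_c leS.
exists A', B', C'; split=> // alpha beta gamma inA inB inC.
rewrite !sum_lfunE big1 // => i _; rewrite !sum_lfunE big1 // => j _.
rewrite !sum_lfunE big1 // => k _; rewrite !scale_lfunE tens3E.
have [iP | iP] := boolP (i \in P); last by rewrite A'0 // !mul0r scaler0.
have [jQ | jQ] := boolP (j \in Q); last by rewrite B'0 // mulr0 mul0r scaler0.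
have [kS | kS] := boolP (k \in S); last by rewrite C'0 // mulr0 scaler0.
by rewrite t0 // scale0r.
Qed.

Theorem theorem3p3 (R : realType) (m : nat) (A B C : vectType R[i])
    (hA : \dim {:A} = m) (hB : \dim {:B} = m) (hC : \dim {:C} = m)
    (T : tensor3 A B C) (hT : tight m T) :
  [/\ compressible (uphalf m) (uphalf m) m./2 T,
      compressible (uphalf m) m./2 (uphalf m) T
    & compressible m./2 (uphalf m) (uphalf m) T].
Proof.
case: hT => a [b [c [t [/basis_free fa /basis_free fb /basis_free fc -> []]]]].
move=> _ [tauA [tauB [tauC [injA injB injC tau0]]]].
have tau_neq0 i j k : tauA i + tauB j + tauC k != 0 -> t i j k = 0.
  by apply: contraNeq => tijk; rewrite tau0 // inE.
have [x [geA leA gtA ltA]] := double_median injA.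
have [y [geB leB gtB ltB]] := double_median injB.
have [z [geC leC gtC ltC]] := double_median injC.
have [ge0 | /ltW le0] := leP 0 (x + y + z).
(* The factor of dimension [m./2] gets the strict inequality. Adding the three gives [2 * (tauA i +
   tauB j + tauC k) > x + y + z]. *)
- split; [ apply: (compressible_of_zero_block fa fb fc geA geB gtC)
         | apply: (compressible_of_zero_block fa fb fc geA gtB geC)
         | apply: (compressible_of_zero_block fa fb fc gtA geB geC) ];
    by move=> i j k; rewrite !inE => *; apply: tau_neq0; lia.
- split; [ apply: (compressible_of_zero_block fa fb fc leA leB ltC)
         | apply: (compressible_of_zero_block fa fb fc leA ltB leC)
         | apply: (compressible_of_zero_block fa fb fc ltA leB leC) ];
    by move=> i j k; rewrite !inE => *; apply: tau_neq0; lia.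
Qed.
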